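(* Let $f$ be an arbitrary element of quantum Minkowski space $\mathcal X$, written as $f\in\mathrm{Span}\,\mathcal B$, where $\mathcal B=\mathcal B_-\cup\mathcal B_+$ with $\mathcal B_-=\{(x^2)^i(x_0)^j(x_{3\setminus0})^k(x_-)^l\}$ and $\mathcal B_+=\{(x^2)^i(x_+)^l(x_0)^j(x_{3\setminus0})^k\}$ ($i,j,k,l\in\mathbb{N}_0$), and with the central elements expressed through the separated variables $\xi_\pm$ by $x_0=\xi_++\xi_-$, $x^2=[2]^2\xi_+\xi_-$. Put $$\delta f:=\Pi_+\bigl(f|_{\xi_+\mapsto q^2\xi_+}-f\bigr)+\Pi_-\bigl(f|_{\xi_-\mapsto q^2\xi_-}-f\bigr).$$ Then $$\begin{aligned}\nabla f&=\frac{\partial_{q^2}f}{\partial_{q^2}\xi_+}\nabla\xi_++\frac{\partial_{q^2}f}{\partial_{q^2}\xi_-}\nabla\xi_-\\&\quad+\frac{\partial_{q^2}f}{\partial_{q^2}x_+}\nabla x_++\frac{\partial_{q^2}f}{\partial_{q^2}x_{3\setminus0}}\nabla x_{3\setminus0}+\frac{\partial_{q^2}f}{\partial_{q^2}x_-}\nabla x_-\\&\quad+\frac{\partial_{q^2}(\delta f)}{\partial_{q^2}x_+}\nabla x_++\frac{\partial_{q^2}(\delta f)}{\partial_{q^2}x_{3\setminus0}}\nabla x_{3\setminus0}+\frac{\partial_{q^2}(\delta f)}{\partial_{q^2}x_-}\nabla x_-\,,\end{aligned}$$ where the partial Jackson derivatives in the last line are to be understood not to act on the matrices $\Pi_\pm$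 contained in $\delta f$.
   Context: Fix a real $q>0$, $q\neq1$. Put $\lambda=q-q^{-1}$, $[n]=\frac{q^n-q^{-n}}{q-q^{-1}}$, $(n)_{q^2}=\frac{q^{2n}-1}{q^2-1}$. Algebra. $\mathcal X$ (quantum Minkowski space) is the unital complex algebra generated by $x_0,x_-,x_+,x_3$ with relations: $x_0$ commutes with all generators; $q^{-1}x_-x_3-qx_3x_-=-\lambda x_-x_0$; $q^{-1}x_3x_+-qx_+x_3=-\lambda x_+x_0$; $x_-x_+-x_+x_--\lambda x_3x_3=-\lambda x_3x_0$. It is graded by degree. Put $x_{3\setminus0}:=x_3-x_0$ and $x^2:=(x_0)^2+q^{-1}x_-x_++qx_+x_--(x_3)^2$. The center $Z$ of $\mathcal X$ is generated by $x_0$ and $x^2$. The set $\mathcal B=\mathcal B_-\cup\mathcal B_+$ is a vector space basis of $\mathcal X$. Calculus. Let $e_0,e_-,e_+,e_3$ be the standard basis of $\mathbb{C}^4$; column vectors in $\mathcal X^4$ are indexed by $\mu\in\{0,-,+,3\}$. Put $e_{--}=[2]^{1/2}e_-$, $e_{-+}=q^{1/2}(e_3-e_0)$, $e_{+-}=q^{-1/2}e_3+q^{3/2}e_0$, $e_{++}=[2]^{1/2}e_+$ (spinor basis). Define $2\times2$ matrices over $\mathcal X$ $$B_{x_0}=\begin{pmatrix}\frac{[4]}{[2]^2}x_0+\frac{\lambda}{q[2]}x_3&q^{-1/2}\lambda[2]^{-1/2}x_+\\-q^{1/2}\lambda[2]^{-1/2}x_-&\frac{[4]}{[2]^2}x_0-\frac{q\lambda}{[2]}x_3\end{pmatrix},\quad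 B_{x_-}=\begin{pmatrix}x_-&q^{-1/2}\lambda[2]^{-1/2}x_{3\setminus0}\\0&x_-\end{pmatrix},$$ $$B_{x_+}=\begin{pmatrix}x_+&0\\-q^{1/2}\lambda[2]^{-1/2}x_{3\setminus0}&x_+\end{pmatrix},\quad B_{x_{3\setminus0}}=\begin{pmatrix}q^{-1}x_{3\setminus0}&0\\0&qx_{3\setminus0}\end{pmatrix},\quad B_{x_3}=B_{x_{3\setminus0}}+B_{x_0},$$ and, as block matrices with respect to the ordered basis $(e_{--},e_{-+},e_{+-},e_{++})$, $$L_{x_0}=\begin{pmatrix}B_{x_0}&0\\0&B_{x_0}\end{pmatrix},\; L_{x_-}=\begin{pmatrix}qB_{x_-}&q^{-1/2}\lambda[2]^{1/2}B_{x_3}\\0&q^{-1}B_{x_-}\end{pmatrix},\; L_{x_+}=\begin{pmatrix}q^{-1}B_{x_+}&0\\0&qB_{x_+}\end{pmatrix},\; L_{x_{3\setminus0}}=\begin{pmatrix}B_{x_{3\setminus0}}&q^{-1/2}\lambda[2]^{1/2}B_{x_+}\\0&B_{x_{3\setminus0}}\end{pmatrix}.$$ These assignments extend to a unital algebra homomorphism $f\mapsto L_f$, $\mathcal X\to M_4(\mathcal X)$. Let $\Lambda:\mathcal X\to M_4(\mathcal X)$ be the algebra homomorphism with $\Lambda(f)=q^nL_f$ for $f$ homogeneous of degree $n$. The gradient $\nabla:\mathcal X\to\mathcal X^4$, with components $(\nabla f)^\mu=\partial^\mu\triangleright f$ (partial derivatives), is the unique linear map with $\nabla1=0$, $\nabla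 x_\alpha=e_\alpha$ ($\alpha\in\{0,-,+,3\}$) and $\nabla(fg)=(\nabla f)g+\Lambda(f)\nabla g$. Separated variables. Let $K=\mathbb{C}(\xi_+,\xi_-)$ be the rational function field, viewed as an extension of $Z$ through $x_0=\xi_++\xi_-$, $x^2=[2]^2\xi_+\xi_-$ (so $\xi_\pm=\frac12(x_0\pm\sqrt{(x_0)^2-\tfrac4{[2]^2}x^2})$ with $\sqrt{(x_0)^2-\tfrac4{[2]^2}x^2}:=\xi_+-\xi_-$). Let $\hat{\mathcal X}=\mathcal X\otimes_ZK$, in which $\xi_\pm$ are central. Put $b=\frac{[2]}2x_0$, $c=(x_0)^2+\frac{\lambda^2}{[2]^2}x^2$, $\sqrt{b^2-c}:=\frac\lambda2(\xi_+-\xi_-)$, and $\Pi_\pm=\frac12\bigl(1\pm\frac{L_{x_0}-b}{\sqrt{b^2-c}}\bigr)\in M_4(\hat{\mathcal X})$; these are complementary orthogonal idempotents. The calculus is extended to $\hat{\mathcal X}$ as follows: $\Lambda$ extends to the algebra homomorphism $\hat{\mathcal X}\to M_4(\hat{\mathcal X})$ with $\Lambda(g)=\Pi_+\,g(q^2\xi_+,\xi_-)+\Pi_-\,g(\xi_+,q^2\xi_-)$ for $g\in K$, and $\nabla$ extends to the linear map $\hat{\mathcal X}\to\hat{\mathcal X}^4$ satisfying $\nabla(fg)=(\nabla f)g+\Lambda(f)\nabla g$. One has $\nabla\xi_\pm=\Pi_\pm\nabla x_0$. Partial Jackson derivatives. After the substitution, $f$ is a linear combination of ordered monomials $\xi_+^m\xi_-^n(x_{3\setminus0})^k(x_-)^l$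 and $\xi_+^m\xi_-^n(x_+)^l(x_{3\setminus0})^k$. For each variable $y$ among $\xi_+,\xi_-,x_+,x_{3\setminus0},x_-$, $\frac{\partial_{q^2}}{\partial_{q^2}y}$ acts linearly and replaces the factor $y^r$ in such an ordered monomial by $(r)_{q^2}y^{r-1}$ (giving $0$ if $y$ does not occur). The substitution $f|_{\xi_\pm\mapsto q^2\xi_\pm}$ replaces only the indicated one of the two variables $\xi_+,\xi_-$ by $q^2$ times itself.
   Formalization: In the first two terms the entries of the columns ∇ξ₊ and ∇ξ₋ are multiplied by the Jackson derivatives of f by ξ₊ and ξ₋ on the right, as in (∇f)g; with entrywise multiplication on the left the formula fails, e.g. for f = x²x₋. *)

(* Defs.v *)
From HB Require Import structures.
From mathcomp Require Import all_boot all_order all_algebra.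
From mathcomp Require Import fraction complex.
From mathcomp Require Import reals.

Set Implicit Arguments.
Unset Strict Implicit.
Unset Printing Implicit Defensive.

Import Order.TTheory GRing.Theory Num.Theory.

Local Open Scope ring_scope.
Local Open Scope complex_scope.

(* The index set {0, -, +, 3}, in this order. *)
Definition i0 : 'I_4 := @Ordinal 4 0 isT.
Definition im : 'I_4 := @Ordinal 4 1 isT.
Definition ip : 'I_4 := @Ordinal 4 2 isT.
Definition i3 : 'I_4 := @Ordinal 4 3 isT.

Section QNumbers.
Context {R : realType}.
Variable q : R.

Definition lambda : R := q - q^-1.
Definition qint (n : nat) : R := (q ^+ n - q ^- n) / (q - q^-1).
Definition jint (n : nat) : R := (q ^+ (2 * n) - 1) / (q ^+ 2 - 1).

(* q^{1/2} and [2]^{1/2} *)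
Definition rq : R := Num.sqrt q.
Definition r2 : R := Num.sqrt (qint 2).

End QNumbers.

Section Minkowski.
Context {R : realType}.
Variable q : R.
Local Notation C := R[i].
Local Notation "p %:F" := (FracField.tofrac p).

Section Generators.
Variables (X : algType C) (x : 'I_4 -> X).

Definition x3m0 : X := x i3 - x i0.

Definition xsq : X :=
  x i0 ^+ 2 + (q^-1)%:C *: (x im * x ip) + q%:C *: (x ip * x im) - x i3 ^+ 2.

Record minkowski_relations : Prop := {
  mink_central : forall a, x i0 * x a = x a * x i0;
  mink_m3 : (q^-1)%:C *: (x im * x i3) - q%:C *: (x i3 * x im)
            = - (lambda q)%:C *: (x im * x i0);
  mink_3p : (q^-1)%:C *: (x i3 * x ip) - q%:C *: (x ip * x i3)
            = - (lambda q)%:C *: (x ip * x i0);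
  mink_mp : x im * x ip - x ip * x im - (lambda q)%:C *: (x i3 * x i3)
            = - (lambda q)%:C *: (x i3 * x i0)
}.

(* f is homogeneous of degree n: a linear combination of words of length n. *)
Definition homogeneous (n : nat) (f : X) : Prop :=
  exists s : seq (C * n.-tuple 'I_4),
    f = \sum_(t <- s) t.1 *: \prod_(a <- t.2) x a.

(* M is the matrix, in the spinor basis (e_--, e_-+, e_+-, e_++), of the
   operator whose matrix in the standard basis is T. *)
Definition spinor_vector (j : 'I_4) : 'cV[C]_4 :=
  let e a : 'cV[C]_4 := delta_mx a 0 in
  nth 0 [:: (r2 q)%:C *: e im;
            (rq q)%:C *: (e i3 - e i0);
            ((rq q)^-1)%:C *: e i3 + (rq q ^+ 3)%:C *: e i0;
            (r2 q)%:C *: e ip] j.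

Definition spinor_mx : 'M[X]_4 :=
  \matrix_(i < 4, j < 4) (spinor_vector j i 0)%:A.

Definition in_spinor_basis (T M : 'M[X]_4) : Prop :=
  T *m spinor_mx = spinor_mx *m M.

Definition mx2 (a b c d : X) : 'M[X]_2 :=
  block_mx (a%:M : 'M_1) (b%:M : 'M_1) (c%:M : 'M_1) (d%:M : 'M_1).

Definition Bx0 : 'M[X]_2 :=
  mx2 ((qint q 4 / qint q 2 ^+ 2)%:C *: x i0
         + (lambda q / (q * qint q 2))%:C *: x i3)
      (((rq q)^-1 * lambda q / r2 q)%:C *: x ip)
      (- (rq q * lambda q / r2 q)%:C *: x im)
      ((qint q 4 / qint q 2 ^+ 2)%:C *: x i0
         - (q * lambda q / qint q 2)%:C *: x i3).

Definition Bxm : 'M[X]_2 :=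
  mx2 (x im) (((rq q)^-1 * lambda q / r2 q)%:C *: x3m0) 0 (x im).

Definition Bxp : 'M[X]_2 :=
  mx2 (x ip) 0 (- (rq q * lambda q / r2 q)%:C *: x3m0) (x ip).

Definition Bx3m0 : 'M[X]_2 := mx2 ((q^-1)%:C *: x3m0) 0 0 (q%:C *: x3m0).

Definition Bx3 : 'M[X]_2 := Bx3m0 + Bx0.

(* On matrices over X, the complex number c acts as the scalar c%:A of X. *)
Record vector_action (L : X -> 'M[X]_4) : Prop := {
  action_scale : forall (c : C) f, L (c *: f) = c%:A *: L f;
  action_x0 : in_spinor_basis (L (x i0)) (block_mx Bx0 0 0 Bx0);
  action_xm : in_spinor_basis (L (x im))
    (block_mx (q%:C%:A *: Bxm) (((rq q)^-1 * lambda q * r2 q)%:C%:A *: Bx3)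
              0 ((q^-1)%:C%:A *: Bxm));
  action_xp : in_spinor_basis (L (x ip))
    (block_mx ((q^-1)%:C%:A *: Bxp) 0 0 (q%:C%:A *: Bxp));
  action_x3m0 : in_spinor_basis (L x3m0)
    (block_mx Bx3m0 (((rq q)^-1 * lambda q * r2 q)%:C%:A *: Bxp) 0 Bx3m0)
}.

Record scaled_action (L Lam : X -> 'M[X]_4) : Prop := {
  scaled_scale : forall (c : C) f, Lam (c *: f) = c%:A *: Lam f;
  scaled_homogeneous : forall n f, homogeneous n f ->
    Lam f = (q ^+ n)%:C%:A *: L f
}.

(* v *m g%:M multiplies the entries of the column v by g on the right. *)
Record gradient (Lam : X -> 'M[X]_4) (nabla : X -> 'cV[X]_4) : Prop := {
  grad_linear : forall (c : C) f g,
    nabla (c *: f + g) = c%:A *: nabla f + nabla g;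
  grad_1 : nabla 1 = 0;
  grad_x : forall a, nabla (x a) = delta_mx a 0;
  grad_mul : forall f g, nabla (f * g) = nabla f *m g%:M + Lam f *m nabla g
}.

End Generators.

(* X is the algebra generated by x_0, x_-, x_+, x_3 subject to
   minkowski_relations and to no other relation. *)
Record quantum_minkowski (X : algType C) (x : 'I_4 -> X) : Prop := {
  mink_rel : minkowski_relations x;
  mink_gen : forall P : X -> Prop,
    (forall a, P (x a)) -> P 1 ->
    (forall (c : C) f g, P f -> P g -> P (c *: f + g)) ->
    (forall f g, P f -> P g -> P (f * g)) ->
    forall f, P f;
  mink_lift : forall (A : algType C) (y : 'I_4 -> A), minkowski_relations y ->
    exists phi : {lrmorphism X -> A}, forall a, phi (x a) = y a
}.

(* C(xi_+, xi_-): the outer variable is xi_+, the inner one is xi_-. *)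
Definition K : fieldType := {fraction {poly {poly C}}}.
Definition cK (c : C) : K := (c%:P%:P : {poly {poly C}})%:F.
Definition rK (r : R) : K := cK r%:C.
Definition xip : K := ('X : {poly {poly C}})%:F.
Definition xin : K := ('X%:P : {poly {poly C}})%:F.

Definition xi_eval (u v : K) (p : {poly {poly C}}) : K :=
  (map_poly (fun r : {poly C} => (map_poly cK r).[v]) p).[u].

Section SeparatedVariables.
Variables (X : algType C) (x : 'I_4 -> X).
Variables (Xh : algType K) (iota : {rmorphism X -> Xh}).

(* The structure map Z -> K is given by x_0 |-> xi_+ + xi_- and
   x^2 |-> [2]^2 xi_+ xi_-; as x_0 and x^2 generate Z, a morphism f on X is
   compatible with it as soon as f is so at these two elements. *)
Definition over_center (A : algType K) (f : X -> A) : Prop :=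
  [/\ forall (c : C) u, f (c *: u) = cK c *: f u,
      f (x i0) = (xip + xin)%:A
    & f (xsq x) = (rK (qint q 2 ^+ 2) * xip * xin)%:A].

(* Xh is the K-algebra obtained from the Z-algebra X by extension of scalars,
   characterised by the universal property of the tensor product over Z. *)
Record separated_extension : Prop := {
  sep_over_center : over_center iota;
  sep_lift : forall (A : algType K) (f : {rmorphism X -> A}), over_center f ->
    exists2 g : {lrmorphism Xh -> A}, forall u, g (iota u) = f u
      & forall g' : {lrmorphism Xh -> A},
          (forall u, g' (iota u) = f u) -> g' =1 g
}.

(* sqrt_bc is the chosen square root of b^2 - c, where
   c = (x_0)^2 + lambda^2 [2]^{-2} x^2. *)
Definition sqrt_bc : K := rK (lambda q / 2) * (xip - xin).

Section Projections.
Variable L : X -> 'M[X]_4.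

Definition Lx0_sub_b : 'M[Xh]_4 :=
  map_mx iota (L (x i0) - ((qint q 2 / 2)%:C *: x i0)%:M).

Definition Pip : 'M[Xh]_4 :=
  (2^-1 : K)%:A *: (1%:M + sqrt_bc^-1%:A *: Lx0_sub_b).

Definition Pim : 'M[Xh]_4 :=
  (2^-1 : K)%:A *: (1%:M - sqrt_bc^-1%:A *: Lx0_sub_b).

(* Every element of K has the form p(xi_+, xi_-) / d(xi_+, xi_-), d <> 0. *)
Record extended_scaled_action
    (Lam : X -> 'M[X]_4) (Lamh : Xh -> 'M[Xh]_4) : Prop := {
  ext_scaled_scale : forall (c : C) f, Lamh (cK c *: f) = (cK c)%:A *: Lamh f;
  ext_scaled_X : forall f, Lamh (iota f) = map_mx iota (Lam f);
  ext_scaled_K : forall p d : {poly {poly C}}, d != 0 ->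
    Lamh (p%:F / d%:F : K)%:A
    = Pip *m (xi_eval (rK (q ^+ 2) * xip) xin p
              / xi_eval (rK (q ^+ 2) * xip) xin d)%:A%:M
    + Pim *m (xi_eval xip (rK (q ^+ 2) * xin) p
              / xi_eval xip (rK (q ^+ 2) * xin) d)%:A%:M
}.

End Projections.

Record extended_gradient (nabla : X -> 'cV[X]_4)
    (Lamh : Xh -> 'M[Xh]_4) (nablah : Xh -> 'cV[Xh]_4) : Prop := {
  ext_grad_linear : forall (c : C) f g,
    nablah (cK c *: f + g) = (cK c)%:A *: nablah f + nablah g;
  ext_grad_X : forall f, nablah (iota f) = map_mx iota (nabla f);
  ext_grad_mul : forall f g,
    nablah (f * g) = nablah f *m g%:M + Lamh f *m nablah g
}.

(* For l = 0 or p = 0 these are the ordered monomials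
   xi_+^m xi_-^n (x_{3\0})^k (x_-)^p and xi_+^m xi_-^n (x_+)^l (x_{3\0})^k. *)
Definition monomial (m n l k p : nat) : Xh :=
  (xip ^+ m * xin ^+ n)
    *: (iota (x ip) ^+ l * iota (x3m0 x) ^+ k * iota (x im) ^+ p).

(* D is C-linear and maps each ordered monomial to the value prescribed by F;
   D is left unspecified outside of the C-span of the ordered monomials. *)
Definition acts_on_monomials (D : Xh -> Xh)
    (F : nat -> nat -> nat -> nat -> nat -> Xh) : Prop :=
  (forall (c : C) f g, D (cK c *: f + g) = cK c *: D f + D g) /\
  (forall m n l k p, l = 0%N \/ p = 0%N ->
     D (monomial m n l k p) = F m n l k p).

Definition jackson_xip (D : Xh -> Xh) : Prop :=
  acts_on_monomials D
    (fun m n l k p => rK (jint q m) *: monomial m.-1 n l k p).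
Definition jackson_xin (D : Xh -> Xh) : Prop :=
  acts_on_monomials D
    (fun m n l k p => rK (jint q n) *: monomial m n.-1 l k p).
Definition jackson_xp (D : Xh -> Xh) : Prop :=
  acts_on_monomials D
    (fun m n l k p => rK (jint q l) *: monomial m n l.-1 k p).
Definition jackson_x3m0 (D : Xh -> Xh) : Prop :=
  acts_on_monomials D
    (fun m n l k p => rK (jint q k) *: monomial m n l k.-1 p).
Definition jackson_xm (D : Xh -> Xh) : Prop :=
  acts_on_monomials D
    (fun m n l k p => rK (jint q p) *: monomial m n l k p.-1).

Definition subst_xip (S : Xh -> Xh) : Prop :=
  acts_on_monomials S
    (fun m n l k p => rK ((q ^+ 2) ^+ m) *: monomial m n l k p).
Definition subst_xin (S : Xh -> Xh) : Prop :=
  acts_on_monomials S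
    (fun m n l k p => rK ((q ^+ 2) ^+ n) *: monomial m n l k p).

(* delta L Sp Sm D f is D (delta f), where D does not act on the matrices
   Pi_+ and Pi_-; the case D = id is delta f. *)
Definition delta (L : X -> 'M[X]_4) (Sp Sm D : Xh -> Xh) (f : Xh) : 'M[Xh]_4 :=
  Pip L *m (D (Sp f - f))%:M + Pim L *m (D (Sm f - f))%:M.

End SeparatedVariables.
End Minkowski.

Arguments K R : clear implicits.
Arguments xip {R}.
Arguments xin {R}.

(* Main.v *)
Require Import Defs.
From HB Require Import structures.
From mathcomp Require Import all_boot all_order all_algebra.
From mathcomp Require Import fraction complex.
From mathcomp Require Import reals.
From mathcomp Require Import ring.

(* The relations order every element of X, so by linearity all that has to be
   checked is the value of nabla on an ordered monomial g y, where g = xi_+^m xi_-^n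
   and y is a monomial in x_+, x_{3\0}, x_-.
   The generators act on each other's gradients by scalars:
     Lambda(x_j) (nabla x_j) = q^2 (nabla x_j) x_j, and
     Lambda(x_i) (nabla x_j) = (nabla x_j) x_i when x_i precedes x_j in y,
   so that nabla y is given by the Jackson derivatives of y, and
   Lambda(g) = q^(2m) g Pi_+ + q^(2n) g Pi_- accounts for the term delta f.
   For xi_+ and xi_-, the corresponding relations follow from the formula for
   Lambda on K alone: multiplicativity forces Pi_+ and Pi_- to be orthogonal
   idempotents, and nabla (xi_+ xi_-) = nabla (xi_- xi_+) then forces
   Pi_- (nabla xi_+) = Pi_+ (nabla xi_-) = 0. *)

Set Implicit Arguments.
Unset Strict Implicit.
Unset Printing Implicit Defensive.

Import Order.TTheory GRing.Theory Num.Theory.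

Local Open Scope ring_scope.
Local Open Scope complex_scope.

(** * Base-ring scalars on matrices over an algebra *)

Section AlgebraMatrices.
Variables (F : comNzRingType) (A : algType F).

Lemma algM (a b : F) : a%:A * b%:A = (a * b)%:A :> A.
Proof. by rewrite mulr_algl scalerA. Qed.

Lemma algX (a : F) n : a%:A ^+ n = (a ^+ n)%:A :> A.
Proof. by rewrite exprZn expr1n. Qed.

Lemma scalemx_alg m n (a : F) (M : 'M[A]_(m, n)) i j :
  (a%:A *: M) i j = a *: M i j.
Proof. by rewrite mxE mulr_algl. Qed.

Lemma scalemx_algA m n (a b : F) (M : 'M[A]_(m, n)) :
  a%:A *: (b%:A *: M) = (a * b)%:A *: M.
Proof. by rewrite scalerA algM. Qed.

Lemma scalemx_algD m n (a b : F) (M : 'M[A]_(m, n)) :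
  (a + b)%:A *: M = a%:A *: M + b%:A *: M.
Proof. by rewrite !scalerDl. Qed.

Lemma mulmx_algr m n p (a : F) (M : 'M[A]_(m, n)) (N : 'M[A]_(n, p)) :
  M *m (a%:A *: N) = a%:A *: (M *m N).
Proof.
apply/matrixP => i j; rewrite scalemx_alg !mxE scaler_sumr.
by apply: eq_bigr => k _; rewrite scalemx_alg scalerAr.
Qed.

Lemma mulmx_alg m n (a : F) (M : 'M[A]_(m, n)) : M *m a%:A%:M = a%:A *: M.
Proof. by rewrite -[a%:A%:M]scalemx1 mulmx_algr mulmx1. Qed.

Lemma scalar_mx_alg n (a : F) (u : A) : (a *: u)%:M = a%:A *: u%:M :> 'M_n.
Proof. by apply/matrixP => i j; rewrite scalemx_alg !mxE scalerMnr. Qed.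

End AlgebraMatrices.

Lemma scalemx_alg_inj (F : fieldType) (A : algType F) m n (a : F)
    (M M' : 'M[A]_(m, n)) :
  a != 0 -> a%:A *: M = a%:A *: M' -> M = M'.
Proof.
move=> a0 /(congr1 (fun B => a^-1%:A *: B)).
by rewrite !scalemx_algA mulVf // !scale1r.
Qed.

(** * Derivations twisted by a homomorphism into matrices *)

Section TwistedDerivation.
Variables (F : comNzRingType) (A : algType F) (n : nat).
Variables (Lam : {rmorphism A -> 'M[A]_n.+1}) (D : A -> 'cV[A]_n.+1).
Hypothesis D_mul : forall f g, D (f * g) = D f *m g%:M + Lam f *m D g.

(** Columns form a right module, so the eigenvalue c f stands to the right of w; in this form the
    relation passes to powers of f. *)
Definition eigencolumn (f : A) (c : F) (w : 'cV[A]_n.+1) : Prop :=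
  Lam f *m w = c%:A *: (w *m f%:M).

Lemma eigencolumnX f c w k :
  eigencolumn f c w -> eigencolumn (f ^+ k) (c ^+ k) w.
Proof.
rewrite /eigencolumn => fw; elim: k => [|k IH].
  by rewrite !expr0 rmorph1 scale1r mulmx1 mul1mx scale1r.
rewrite exprS rmorphM -mulmxA IH mulmx_algr mulmxA fw -scalemxAl scalemx_algA.
by rewrite -mulmxA -scalar_mxM -exprSr -exprS.
Qed.

Lemma derivation1 : D 1 = 0.
Proof.
have := D_mul 1 1; rewrite mul1r rmorph1 mulmx1 mul1mx.
by move/eqP; rewrite -subr_eq subrr eq_sym => /eqP.
Qed.

(** In the product rule, moving [Lam (f ^+ i)] past D f costs [c ^+ i]; these factors add up to the
    geometric sum, a Jackson number when c = q^2. *)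
Lemma derivationX f c k : eigencolumn f c (D f) ->
  D (f ^+ k) = (\sum_(i < k) c ^+ i)%:A *: (D f *m (f ^+ k.-1)%:M).
Proof.
move=> ff; elim: k => [|k IH]; first by rewrite derivation1 big_ord0 !scale0r.
rewrite exprSr D_mul IH (eigencolumnX k ff) -scalemxAl -mulmxA -scalar_mxM.
rewrite -exprSr big_ord_recr /= !scalerDl; congr (_ + _).
(* For k = 0 the exponent [k.-1] is truncated, but the empty sum kills the term. *)
by case: k {IH} => [|k] //; rewrite big_ord0 !scale0r.
Qed.

Lemma derivationXX f g c k p :
  eigencolumn f c (D f) -> eigencolumn g c (D g) -> eigencolumn f 1 (D g) ->
  D (f ^+ k * g ^+ p)
  = (\sum_(i < k) c ^+ i)%:A *: (D f *m (f ^+ k.-1 * g ^+ p)%:M)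
    + (\sum_(i < p) c ^+ i)%:A *: (D g *m (f ^+ k * g ^+ p.-1)%:M).
Proof.
move=> ff gg fg; rewrite D_mul (derivationX k ff) (derivationX p gg).
rewrite -scalemxAl -mulmxA -scalar_mxM; congr (_ + _).
rewrite mulmx_algr mulmxA (eigencolumnX k fg) expr1n !scale1r.
by rewrite -mulmxA -scalar_mxM.
Qed.

End TwistedDerivation.

(** * Two projections, and the twisted product rule on ordered monomials *)

Section SpectralProjections.
Variables (F : fieldType) (A : algType F) (n : nat).
Variables (Lam : {rmorphism A -> 'M[A]_n.+1}) (D : A -> 'cV[A]_n.+1).
Hypothesis D_mul : forall f g, D (f * g) = D f *m g%:M + Lam f *m D g.
Variables (P N : 'M[A]_n.+1) (u v s : F).
Hypotheses (u_neq0 : u != 0) (v_neq0 : v != 0) (s_neq1 : s != 1).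
Hypothesis PN1 : P + N = 1%:M.
Hypothesis Lam_uv : forall i j, Lam (u ^+ i * v ^+ j)%:A
  = (s ^+ i * (u ^+ i * v ^+ j))%:A *: P
    + (s ^+ j * (u ^+ i * v ^+ j))%:A *: N.

Lemma scalemx_alg_subr1 m k (a : F) (M : 'M[A]_(m, k)) :
  M + (a - 1)%:A *: M = a%:A *: M.
Proof. by rewrite !scalerBl !scale1r addrC subrK. Qed.

(** Eliminating the complementary projection leaves the identity plus a multiple of M, so that
    expansions can be compared by cancellation. *)
Lemma projection_combine (M M' : 'M[A]_n.+1) (a b : F) : M + M' = 1%:M ->
  (a * b)%:A *: M + b%:A *: M' = b%:A *: (1%:M + (a - 1)%:A *: M).
Proof.
move=> <-; rewrite (addrAC M) scalemx_alg_subr1 scalerDr scalemx_algA.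
by rewrite mulrC.
Qed.

Lemma Lam_u i : Lam (u ^+ i)%:A = (u ^+ i)%:A *: (1%:M + (s ^+ i - 1)%:A *: P).
Proof.
have := Lam_uv i 0; rewrite expr0 mulr1 mul1r => ->.
by rewrite projection_combine.
Qed.

Lemma Lam_v i : Lam (v ^+ i)%:A = (v ^+ i)%:A *: (1%:M + (s ^+ i - 1)%:A *: N).
Proof.
have := Lam_uv 0 i; rewrite expr0 !mul1r addrC => ->.
by rewrite projection_combine // addrC.
Qed.

(* Compare Lam u ^ 2 = u^2 (1 + (s - 1) P)^2 with
   Lam (u ^ 2) = u^2 (1 + (s^2 - 1) P). *)
Lemma P_idem : P *m P = P.
Proof.
have s1 : s - 1 != 0 by rewrite subr_eq0.
have E : Lam u%:A *m Lam u%:A = Lam (u ^+ 2)%:A.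
  by rewrite [LHS](esym (rmorphM Lam _ _)) algM.
move: E; rewrite -{1 2}[u]expr1 !Lam_u !expr1 mulmx_algr -scalemxAl scalemx_algA.
move/scalemx_alg_inj => /(_ (expf_neq0 2 u_neq0)).
rewrite mulmxDl mul1mx mulmxDr mulmx1 -addrA => /addrI.
(* The two linear terms match those of the expanded square; only the multiples of P P and P by (s -
   1)^2 remain. *)
have -> : s ^+ 2 - 1 = (s - 1) + ((s - 1) + (s - 1) * (s - 1)) by ring.
rewrite !(scalemx_algD (s - 1)) => /addrI /addrI.
rewrite mulmx_algr -scalemxAl scalemx_algA.
by move/scalemx_alg_inj; apply; rewrite mulf_neq0.
Qed.

Lemma PN0 : P *m N = 0.
Proof.
have -> : N = 1%:M - P by rewrite -PN1 addrC addKr.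
by rewrite mulmxBr mulmx1 P_idem subrr.
Qed.

(* The two expansions of D (u v) = D (v u) give u P (D v) = v N (D u); apply P. *)
Lemma P_Dv_N_Du : P *m D v%:A = 0 /\ N *m D u%:A = 0.
Proof.
have s1 : s - 1 != 0 by rewrite subr_eq0.
have E : v%:A *: (N *m D u%:A) = u%:A *: (P *m D v%:A).
  have : D (u%:A * v%:A) = D (v%:A * u%:A) by rewrite !algM mulrC.
  have := Lam_u 1; have := Lam_v 1; rewrite !expr1 => Lv Lu.
  rewrite !D_mul !mulmx_alg Lu Lv.
  rewrite -!scalemxAl !mulmxDl !mul1mx -!scalemxAl !scalerDr !scalemx_algA.
  rewrite addrA [X in _ = X]addrA [X in _ = X + _]addrC => /addrI.
  rewrite ![_ * (s - 1)]mulrC -!scalemx_algA.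
  by move/(scalemx_alg_inj s1) => ->.
have Pv : P *m D v%:A = 0.
  have := congr1 (mulmx P) E.
  rewrite !mulmx_algr !mulmxA P_idem PN0 mul0mx scaler0 => /esym.
  by rewrite -[RHS](scaler0 _ u%:A) => /(scalemx_alg_inj u_neq0).
split=> //; move: E; rewrite Pv scaler0 -[RHS](scaler0 _ v%:A).
exact: scalemx_alg_inj.
Qed.

Lemma P_Du : P *m D u%:A = D u%:A.
Proof. by rewrite -[RHS]mul1mx -PN1 mulmxDl (P_Dv_N_Du).2 addr0. Qed.

Lemma N_Dv : N *m D v%:A = D v%:A.
Proof. by rewrite -[RHS]mul1mx -PN1 mulmxDl (P_Dv_N_Du).1 add0r. Qed.

(** D u is fixed by P, and [Lam u%:A] is multiplication by s u on such columns. *)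
Lemma eigencolumn_u : eigencolumn Lam u%:A s (D u%:A).
Proof.
rewrite /eigencolumn mulmx_alg scalemx_algA -{1}[u]expr1 Lam_u !expr1.
rewrite -scalemxAl mulmxDl mul1mx -scalemxAl P_Du.
by rewrite scalemx_alg_subr1 scalemx_algA mulrC.
Qed.

Lemma eigencolumn_v : eigencolumn Lam v%:A s (D v%:A).
Proof.
rewrite /eigencolumn mulmx_alg scalemx_algA -{1}[v]expr1 Lam_v !expr1.
rewrite -scalemxAl mulmxDl mul1mx -scalemxAl N_Dv.
by rewrite scalemx_alg_subr1 scalemx_algA mulrC.
Qed.

(** P kills D v, so only the identity part of [Lam u%:A] acts on it. *)
Lemma eigencolumn_uv : eigencolumn Lam u%:A 1 (D v%:A).
Proof.
rewrite /eigencolumn mulmx_alg scalemx_algA -{1}[u]expr1 Lam_u !expr1.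
by rewrite -scalemxAl mulmxDl mul1mx -scalemxAl (P_Dv_N_Du).1 scaler0 addr0 mul1r.
Qed.

Lemma derivation_uv i j : D (u ^+ i * v ^+ j)%:A
  = (\sum_(k < i) s ^+ k)%:A *: (D u%:A *m (u ^+ i.-1 * v ^+ j)%:A%:M)
    + (\sum_(k < j) s ^+ k)%:A *: (D v%:A *m (u ^+ i * v ^+ j.-1)%:A%:M).
Proof.
rewrite -!algM -!algX.
exact: derivationXX eigencolumn_u eigencolumn_v eigencolumn_uv.
Qed.

Definition central_column (w : 'cV[A]_n.+1) : Prop :=
  forall a : A, a%:M *m w = w *m a%:M.

(** This is the origin of the delta terms. Split w z as P w z + N w z; adding the corrections with
    s^i - 1 and s^j - 1 turns the coefficients into s^i and s^j, which are those of [Lam_uv]. *)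
Lemma delta_terms (w : 'cV[A]_n.+1) (i j : nat) (a : F) (y : A) :
  central_column w -> let z := a *: ((u ^+ i * v ^+ j) *: y) in
  w *m z%:M + (P *m ((s ^+ i - 1) *: z)%:M + N *m ((s ^+ j - 1) *: z)%:M) *m w
  = Lam (u ^+ i * v ^+ j)%:A *m (a%:A *: (w *m y%:M)).
Proof.
move=> wc z; rewrite mulmxDl -!mulmxA !wc Lam_uv mulmxDl -!scalemxAl /z {z}.
move: (u ^+ i * v ^+ j) => g; rewrite scalerA.
rewrite !mulmx_algr !scalemx_algA -!mulrA (mulrC g); move: (a * g) => c.
rewrite !scalar_mx_alg !mulmx_algr; move: (w *m y%:M) => W.
rewrite -{1}[W]mul1mx -PN1 mulmxDl scalerDr addrACA.
by rewrite !scalemx_alg_subr1 !scalemx_algA.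
Qed.

Variables (e f g : A).
Hypotheses (ee : eigencolumn Lam e s (D e)) (ff : eigencolumn Lam f s (D f)).
Hypotheses (gg : eigencolumn Lam g s (D g)).
Hypotheses (ef : eigencolumn Lam e 1 (D f)) (fg : eigencolumn Lam f 1 (D g)).

(** Here e, f, g stand for x_+, x_{3\0}, x_-. As e and g never occur together, each monomial is a
    product of powers of two neighbours, and the term of the absent variable has an empty sum. *)
Lemma derivation_ordered l k p : l = 0%N \/ p = 0%N ->
  D (e ^+ l * f ^+ k * g ^+ p)
  = (\sum_(i < l) s ^+ i)%:A *: (D e *m (e ^+ l.-1 * f ^+ k * g ^+ p)%:M)
    + (\sum_(i < k) s ^+ i)%:A *: (D f *m (e ^+ l * f ^+ k.-1 * g ^+ p)%:M)
    + (\sum_(i < p) s ^+ i)%:A *: (D g *m (e ^+ l * f ^+ k * g ^+ p.-1)%:M).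
Proof.
case=> ->; rewrite !expr0 big_ord0 !scale0r ?mul1r ?mulr1 ?add0r ?addr0.
  exact: derivationXX.
exact: derivationXX.
Qed.

Hypotheses (ec : central_column (D e)) (fc : central_column (D f)).
Hypotheses (gc : central_column (D g)).

Let mono i j l k p := (u ^+ i * v ^+ j) *: (e ^+ l * f ^+ k * g ^+ p).

Lemma gradient_mono i j l k p : l = 0%N \/ p = 0%N ->
  let h := mono i j l k p in
  let he := (\sum_(r < l) s ^+ r) *: mono i j l.-1 k p in
  let hf := (\sum_(r < k) s ^+ r) *: mono i j l k.-1 p in
  let hg := (\sum_(r < p) s ^+ r) *: mono i j l k p.-1 in
  let d y := P *m ((s ^+ i - 1) *: y)%:M + N *m ((s ^+ j - 1) *: y)%:M in
  D h = D u%:A *m ((\sum_(r < i) s ^+ r) *: mono i.-1 j l k p)%:M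
    + D v%:A *m ((\sum_(r < j) s ^+ r) *: mono i j.-1 l k p)%:M
    + D e *m he%:M + D f *m hf%:M + D g *m hg%:M
    + d he *m D e + d hf *m D f + d hg *m D g.
Proof.
move=> lp h he hf hg d.
rewrite /h /mono -[in LHS]mulr_algl [LHS]D_mul derivation_uv derivation_ordered //.
rewrite mulmxDl -!scalemxAl -!mulmxA -!scalar_mxM !mulr_algl.
rewrite (scalar_mx_alg _ (\sum_(r < i) _)) (scalar_mx_alg _ (\sum_(r < j) _)).
rewrite !(mulmx_algr _ (D _)) -!addrA; congr (_ + (_ + _)).
(* Each of the three terms under [Lam] splits into its plain Jackson term and its delta term. *)
rewrite !mulmxDr -!delta_terms //.
rewrite -/(mono i j l.-1 k p) -/(mono i j l k.-1 p) -/(mono i j l k p.-1).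
rewrite -/he -/hf -/hg -/(d he) -/(d hf) -/(d hg) !addrA.
by rewrite [LHS](ACl (1*3*5*2*4*6)).
Qed.

End SpectralProjections.

(** * The field C(xi_+, xi_-) and evaluation in it *)

Section Constants.
Variable R : realType.
Implicit Types a b c : R[i].

HB.instance Definition _ := GRing.RMorphism.copy (@cK R)
  (@FracField.tofrac {poly {poly R[i]}} \o (@polyC {poly R[i]} \o @polyC R[i])).

HB.instance Definition _ := GRing.RMorphism.copy (@rK R)
  (@cK R \o real_complex R).

Lemma xip_neq0 : xip != 0 :> K R.
Proof. by rewrite /xip tofrac_eq0 polyX_eq0. Qed.

Lemma xin_neq0 : xin != 0 :> K R.
Proof. by rewrite /xin tofrac_eq0 polyC_eq0 polyX_eq0. Qed.

(** Written as a composite of ring morphisms, evaluation becomes multiplicative by the generic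
    morphism rules. *)
Lemma xi_evalE (u v : K R) p : xi_eval u v p
  = horner_eval u (map_poly (horner_eval v \o map_poly (@cK R)) p).
Proof. by []. Qed.

Lemma xi_eval1 (u v : K R) : xi_eval u v 1 = 1.
Proof. by rewrite xi_evalE !rmorph1. Qed.

Lemma xi_eval_monomial (u v : K R) i j :
  xi_eval u v ('X ^+ i * 'X%:P ^+ j) = u ^+ i * v ^+ j.
Proof.
rewrite xi_evalE !rmorphM !rmorphXn /= map_polyX map_polyC /= map_polyX.
by rewrite /horner_eval !hornerE.
Qed.

End Constants.

(** * Normal ordering of x_+, x_{3\0} and x_- *)

Section OrderingRelations.
Variables (F : fieldType) (A : algType F) (E Z G : A) (k t r : F).
Hypothesis k_neq0 : k != 0.
Let l := k - k^-1.
(** [E], [Z], [G] stand for x_+, x_{3\0}, x_-; after extension of scalars, x_0 is the scalar t and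
    x^2 the scalar r. *)
Let X3 := Z + t%:A.

(** Passing from x_3 to x_{3\0} cancels the terms in x_0 on both sides, since (k^-1 - k) t W = - l t
    W. *)
Lemma order_relation (U V W : A) :
  k^-1 *: (U + t *: W) - k *: (V + t *: W) = - l *: (t *: W) ->
  U = k ^+ 2 *: V.
Proof.
rewrite /l opprB [RHS]scalerBl !scalerDr opprD addrACA.
move/(canRL (addrK _)); rewrite subrr => /subr0_eq /(congr1 ( *:%R k)).
by rewrite !scalerA divff // scale1r expr2.
Qed.

Lemma order_ZE :
  k^-1 *: (X3 * E) - k *: (E * X3) = - l *: (E * t%:A) ->
  Z * E = k ^+ 2 *: (E * Z).
Proof. rewrite mulrDl mulrDr mulr_algl mulr_algr; exact: order_relation. Qed.

Lemma order_GZ :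
  k^-1 *: (G * X3) - k *: (X3 * G) = - l *: (G * t%:A) ->
  G * Z = k ^+ 2 *: (Z * G).
Proof. rewrite mulrDl mulrDr mulr_algl mulr_algr; exact: order_relation. Qed.

Lemma order_GE :
  G * E - E * G - l *: (X3 * X3) = - l *: (X3 * t%:A) ->
  G * E = E * G + l *: (Z * Z + t *: Z).
Proof.
rewrite -addrA -opprD scaleNr => /(canRL (subrK _)) ->.
rewrite addrCA; congr (_ + _); rewrite addrC -scalerBr -mulrBr.
by rewrite addrK mulrDl mulr_algl.
Qed.

(** Substituting the formula for G E into x^2 = r leaves k^-1 + k as the coefficient of E G, and one
    divides by it. *)
Lemma order_EG : k^-1 + k != 0 ->
  G * E = E * G + l *: (Z * Z + t *: Z) ->
  t%:A ^+ 2 + k^-1 *: (G * E) + k *: (E * G) - X3 ^+ 2 = r%:A ->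
  E * G = ((k^-1 + k)^-1 * r)%:A
          + ((k^-1 + k)^-1 * (1 - k^-1 * l)) *: (Z * Z)
          + ((k^-1 + k)^-1 * (2 - k^-1 * l)) *: (t *: Z).
Proof.
rewrite -!(scalerA (k^-1 + k)^-1) -!(scalerDr (k^-1 + k)^-1).
move=> d0 ->; rewrite /X3; clearbody l.
rewrite !expr2 mulrDl !mulrDr !mulr_algl !mulr_algr -!addrA scalerDr !opprD !addrA.
(* The two multiples of E G are brought together, and the two squares of t cancel. *)
rewrite [X in X = _](ACl ((2*4)*(1*8)*(3*5*6*7)))/= subrr addr0 -scalerDl.
move=> /(canRL (addrK _)) /(congr1 ( *:%R (k^-1 + k)^-1)).
rewrite scalerA mulVf // scale1r => ->.
congr (_ *: _); rewrite -[RHS]addrA; congr (_ + _).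
rewrite !(scalerDr, scalerBl, scalerDl, scale1r, scalerA, opprD, opprK, addrA).
by rewrite [LHS](ACl (3*1*4*5*2))/= ?scaleNr.
Qed.

End OrderingRelations.

Section CoefficientMorphism.
Variables (F F' : fieldType) (phi : {rmorphism F -> F'}) (k : F).

Lemma rmorph_EG_denom : phi (k^-1 + k)^-1 = ((phi k)^-1 + phi k)^-1.
Proof. by rewrite fmorphV rmorphD fmorphV. Qed.

(** Used to recognise the coefficients of E G as images of real constants, which is what stability
    of the complex span requires. *)
Lemma rmorph_EG_coef c : phi ((k^-1 + k)^-1 * (c - k^-1 * (k - k^-1)))
  = ((phi k)^-1 + phi k)^-1 * (phi c - (phi k)^-1 * (phi k - (phi k)^-1)).
Proof. by rewrite rmorphM rmorph_EG_denom !(rmorphB, rmorphM, fmorphV). Qed.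

End CoefficientMorphism.

Lemma skew_commrX (F : comNzRingType) (A : algType F) (c : F) (u v : A) n :
  u * v = c *: (v * u) -> u * v ^+ n = c ^+ n *: (v ^+ n * u).
Proof.
move=> uv; elim: n => [|n IH]; first by rewrite mul1r mulr1 scale1r.
rewrite [v ^+ _ in LHS]exprSr mulrA IH -scalerAl -mulrA uv -scalerAr scalerA.
by rewrite mulrA -!exprSr.
Qed.

(** The factor [e ^+ 0] is kept so that both sides have the literal shape of [monomial]. *)
Lemma skew_monomial_l (F : comNzRingType) (A : algType F) (c g : F) (e z w : A)
    j p :
  w * z = c *: (z * w) ->
  w * (g *: (e ^+ 0 * z ^+ j * w ^+ p))
  = c ^+ j *: (g *: (e ^+ 0 * z ^+ j * w ^+ p.+1)).
Proof.
move=> wz; rewrite !expr0 !mul1r -scalerAr mulrA (skew_commrX j wz) -scalerAl.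
by rewrite -mulrA -exprS !scalerA mulrC.
Qed.

(** Moves e through the powers of z until it meets a factor w, so that e w can be rewritten in terms
    of z. *)
Lemma skew_monomial_r (F : comNzRingType) (A : algType F) (c g : F) (e z w : A)
    j p :
  e * z = c *: (z * e) ->
  e * (g *: (e ^+ 0 * z ^+ j * w ^+ p.+1))
  = c ^+ j *: (z ^+ j * (e * w * (g *: (e ^+ 0 * z ^+ 0 * w ^+ p)))).
Proof.
move=> ez; rewrite !expr0 !mul1r -[LHS]scalerAr [e * (_ * _)]mulrA.
by rewrite (skew_commrX j ez) -scalerAl exprS -!scalerAr !scalerA !mulrA mulrC.
Qed.

Lemma quadratic_mul (F : comNzRingType) (A : algType F) (a u v b c t : F)
    (z h : A) :
  ((a * u * v)%:A + b *: (z * z) + c *: (t *: z)) * h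
  = a *: (u *: (v *: h)) + b *: (z * (z * h)) + c *: (t *: (z * h)).
Proof. by rewrite !mulrDl -!scalerAl mul1r -!scalerA -mulrA. Qed.

(** * Ordered monomials span the image of X over the complex numbers *)

Section OrderedSpan.
Variables (R : realType) (q : R) (q_gt0 : 0 < q) (X : algType R[i]).
Variables (x : 'I_4 -> X) (Xh : algType (K R)) (iota : {rmorphism X -> Xh}).
Hypotheses (Hrel : minkowski_relations q x) (Hover : over_center q x iota).

Let E := iota (x ip).
Let Z := iota (x3m0 x).
Let G := iota (x im).
Let k : K R := rK q.
Let t : K R := xip + xin.

(** Only complex coefficients and natural powers of xi_+ and xi_- are allowed: this is exactly where
    the Jackson derivatives are specified. *)
Inductive ordered_span : Xh -> Prop :=
| span_monomial m n l j p :
    l = 0%N \/ p = 0%N -> ordered_span (monomial x iota m n l j p)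
| span_linear (c : R[i]) f g :
    ordered_span f -> ordered_span g -> ordered_span (cK c *: f + g).

Lemma span0 : ordered_span 0.
Proof.
have M := @span_monomial 0 0 0 0 0 (or_introl erefl).
rewrite -(addNr (monomial x iota 0 0 0 0 0)) -scaleN1r.
by rewrite -(rmorphN1 (@cK R)); apply: span_linear.
Qed.

Lemma spanZ c f : ordered_span f -> ordered_span (cK c *: f).
Proof. by move=> fS; rewrite -[_ *: _]addr0; apply: span_linear span0. Qed.

Lemma spanD f g : ordered_span f -> ordered_span g -> ordered_span (f + g).
Proof.
by move=> fS; rewrite -[f]scale1r -(rmorph1 (@cK R)); apply: span_linear.
Qed.

Lemma span_xip f : ordered_span f -> ordered_span (xip *: f).
Proof.
elim=> [m n l j p lp|c g h _ IHg _ IHh].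
  by rewrite scalerA mulrA -exprS; apply: span_monomial.
by rewrite scalerDr scalerA mulrC -scalerA; apply: span_linear.
Qed.

Lemma span_xin f : ordered_span f -> ordered_span (xin *: f).
Proof.
elim=> [m n l j p lp|c g h _ IHg _ IHh].
  by rewrite scalerA mulrCA -exprS; apply: span_monomial.
by rewrite scalerDr scalerA mulrC -scalerA; apply: span_linear.
Qed.

Lemma span_t f : ordered_span f -> ordered_span (t *: f).
Proof.
by move=> fS; rewrite scalerDl; apply: spanD; [apply: span_xip|apply: span_xin].
Qed.

Lemma k_neq0 : k != 0.
Proof. by rewrite fmorph_eq0 gt_eqF. Qed.

Lemma iota_scale (r : R) u : iota (r%:C *: u) = rK r *: iota u.
Proof. by case: Hover => ->. Qed.

Lemma iota_x0 : iota (x i0) = t%:A.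
Proof. by case: Hover. Qed.

Lemma iota_x3 : iota (x i3) = Z + t%:A.
Proof. by rewrite /Z /x3m0 rmorphB iota_x0 subrK. Qed.

Lemma rK_lambda : rK (lambda q) = k - k^-1.
Proof. by rewrite rmorphB /= fmorphV. Qed.

Lemma Minkowski_ZE : Z * E = k ^+ 2 *: (E * Z).
Proof.
apply: (@order_ZE _ _ E Z k t k_neq0); have := congr1 iota (mink_3p Hrel).
rewrite -rmorphN rmorphB /= !iota_scale !rmorphM /= !iota_x3 iota_x0.
by rewrite rmorphN fmorphV /= rK_lambda.
Qed.

Lemma Minkowski_GZ : G * Z = k ^+ 2 *: (Z * G).
Proof.
apply: (@order_GZ _ _ Z G k t k_neq0); have := congr1 iota (mink_m3 Hrel).
rewrite -rmorphN rmorphB /= !iota_scale !rmorphM /= !iota_x3 iota_x0.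
by rewrite rmorphN fmorphV /= rK_lambda.
Qed.

Lemma Minkowski_GE : G * E = E * G + (k - k^-1) *: (Z * Z + t *: Z).
Proof.
apply: (@order_GE _ _ E Z G k t); have := congr1 iota (mink_mp Hrel).
rewrite -rmorphN [X in X = _ -> _]rmorphB /= [iota (_ - _)]rmorphB /= !iota_scale.
by rewrite !rmorphM /= !iota_x3 iota_x0 rmorphN /= rK_lambda.
Qed.

Lemma Minkowski_EG : exists a b c : R,
  E * G = (rK a * xip * xin)%:A + rK b *: (Z * Z) + rK c *: (t *: Z).
Proof.
have d0 : k^-1 + k != 0.
  by rewrite -fmorphV -rmorphD fmorph_eq0 gt_eqF // addr_gt0 ?invr_gt0.
have [_ _ Hsq] := Hover.
move: (qint q 2 ^+ 2) Hsq => c.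
rewrite /xsq rmorphB !rmorphD /= !rmorphXn /= !iota_scale !rmorphM /=.
rewrite iota_x3 iota_x0 fmorphV /= => /(order_EG d0 Minkowski_GE) ->.
exists ((q^-1 + q)^-1 * c), ((q^-1 + q)^-1 * (1 - q^-1 * (q - q^-1))).
exists ((q^-1 + q)^-1 * (2 - q^-1 * (q - q^-1))).
rewrite !rmorph_EG_coef [rK (_ * _)]rmorphM rmorph_EG_denom -/k.
by rewrite /= rmorph1 (rmorph_nat (@rK R) 2) -/k -!mulrA.
Qed.

Lemma spanR (r : R) f : ordered_span f -> ordered_span (rK r *: f).
Proof. exact: spanZ. Qed.

Lemma span_kX n f : ordered_span f -> ordered_span ((k ^+ 2) ^+ n *: f).
Proof. by rewrite -!(rmorphXn (@rK R)); apply: spanR. Qed.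

Lemma span_kXV n f : ordered_span f -> ordered_span ((k ^+ 2)^-1 ^+ n *: f).
Proof.
by rewrite -(rmorphXn (@rK R)) -(fmorphV (@rK R)) -(rmorphXn (@rK R)); apply: spanR.
Qed.

(** Z moves past the power of E at the cost of a power of q^2 and joins the power of Z. *)
Lemma span_Z f : ordered_span f -> ordered_span (Z * f).
Proof.
elim=> [m n l j p lp|c g h _ IHg _ IHh]; last first.
  by rewrite mulrDr -scalerAr; apply: span_linear.
rewrite -scalerAr !mulrA (skew_commrX l Minkowski_ZE) -!scalerAl -(mulrA _ Z).
rewrite -exprS scalerA mulrC -scalerA; apply: span_kX.
exact: span_monomial.
Qed.

Lemma span_ZX j f : ordered_span f -> ordered_span (Z ^+ j * f).
Proof.
move=> fS; elim: j => [|j IH]; first by rewrite mul1r.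
by rewrite exprS -mulrA; apply: span_Z.
Qed.

Lemma span_quadratic (a b c : R) f : ordered_span f -> ordered_span
  (((rK a * xip * xin)%:A + rK b *: (Z * Z) + rK c *: (t *: Z)) * f).
Proof.
move=> fS; rewrite quadratic_mul.
have ZfS := span_Z fS.
apply: spanD; [apply: spanD|]; apply: spanR.
- exact/span_xip/span_xin.
- exact: span_Z.
- exact: span_t.
Qed.

Lemma span_EG f : ordered_span f -> ordered_span (E * G * f).
Proof.
by move=> fS; have [a [b [c ->]]] := Minkowski_EG; apply: span_quadratic.
Qed.

Lemma span_GE f : ordered_span f -> ordered_span (G * E * f).
Proof.
move=> fS; rewrite Minkowski_GE mulrDl; apply: spanD; first exact: span_EG.
rewrite -rK_lambda -scalerAl mulrDl -scalerAl -mulrA.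
have ZfS := span_Z fS.
by apply: spanR; apply: spanD; [apply: span_Z|apply: span_t].
Qed.

(** Without a factor G, the exponent of E just grows. Otherwise E is absent from the monomial, and
    the new E crosses the power of Z and is absorbed with one G by [span_EG]. *)
Lemma span_E f : ordered_span f -> ordered_span (E * f).
Proof.
elim=> [m n l j p lp|c g h _ IHg _ IHh]; last first.
  by rewrite mulrDr -scalerAr; apply: span_linear.
have EZ : E * Z = (k ^+ 2)^-1 *: (Z * E).
  by rewrite Minkowski_ZE scalerA mulVf ?scale1r // expf_neq0 ?k_neq0.
case: p lp => [|p] lp.
  by rewrite -scalerAr !mulrA -exprS; apply: span_monomial; right.
have -> : l = 0%N by case: lp.
rewrite (skew_monomial_r _ _ _ _ EZ); apply/span_kXV/span_ZX/span_EG.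
by apply: (@span_monomial m n 0 0 p); left.
Qed.

(** Mirror image of [span_E]: G either crosses the power of Z, or meets the first E directly. *)
Lemma span_G f : ordered_span f -> ordered_span (G * f).
Proof.
elim=> [m n l j p lp|c g h _ IHg _ IHh]; last first.
  by rewrite mulrDr -scalerAr; apply: span_linear.
case: l lp => [|l] lp.
  rewrite (skew_monomial_l _ _ _ _ Minkowski_GZ); apply: span_kX.
  by apply: (@span_monomial m n 0 j p.+1); left.
have -> : p = 0%N by case: lp.
have -> : G * monomial x iota m n l.+1 j 0 = G * E * monomial x iota m n l j 0.
  by rewrite -!scalerAr exprS !mulrA.
by apply/span_GE/span_monomial; right.
Qed.

Hypothesis mink_gen : forall P : X -> Prop,
  (forall a, P (x a)) -> P 1 ->
  (forall (c : R[i]) f g, P f -> P g -> P (c *: f + g)) ->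
  (forall f g, P f -> P g -> P (f * g)) ->
  forall f, P f.

Lemma iota_span f : ordered_span (iota f).
Proof.
(* Stability under left multiplication is the stronger claim that survives products in the induction
   over generators. *)
suff S u h : ordered_span h -> ordered_span (iota u * h).
  have := S f 1; rewrite mulr1; apply.
  have := @span_monomial 0 0 0 0 0 (or_introl erefl).
  by rewrite /monomial !expr0 !mul1r scale1r.
elim/mink_gen: u h => [a||c u v IHu IHv|u v IHu IHv] h hS.
- have tS : ordered_span (iota (x i0) * h).
    by rewrite iota_x0 mulr_algl; apply: span_t.
  case: a => -[|[|[|[|//]]]] a4.
  + by rewrite (_ : Ordinal a4 = i0); last exact: val_inj.
  + by rewrite (_ : Ordinal a4 = im); [apply: span_G|apply: val_inj].
  + by rewrite (_ : Ordinal a4 = ip); [apply: span_E|apply: val_inj].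
  + rewrite (_ : Ordinal a4 = i3); last exact: val_inj.
    rewrite -[x i3](subrK (x i0)) rmorphD mulrDl.
    by apply: spanD => //; apply: span_Z.
- by rewrite rmorph1 mul1r.
- rewrite rmorphD mulrDl; apply: spanD; last exact: IHv.
  by case: Hover => -> _ _; rewrite -scalerAl; apply/spanZ/IHu.
- by rewrite rmorphM -mulrA; apply/IHu/IHv.
Qed.

End OrderedSpan.

(** * Eigenvectors of block triangular matrices *)

Section BlockEigenvectors.
Variables (F : comNzRingType) (A : algType F).

Definition right_eigen n (M : 'M[A]_n) (v : 'cV[A]_n) (f : A) : Prop :=
  M *m v = v *m f%:M.

Lemma right_eigenZ n (M : 'M[A]_n) v f (c : F) :
  right_eigen M v f -> right_eigen (c%:A *: M) v (c *: f).
Proof.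
by rewrite /right_eigen -scalemxAl => ->; rewrite scalar_mx_alg mulmx_algr.
Qed.

Lemma right_eigen_block_l m n (M : 'M[A]_m) (N : 'M[A]_(m, n)) (P : 'M[A]_n) v f :
  right_eigen M v f -> right_eigen (block_mx M N 0 P) (col_mx v 0) f.
Proof.
rewrite /right_eigen => Mv.
by rewrite mul_block_col mul_col_mx !mulmx0 !mul0mx !addr0 Mv.
Qed.

Lemma right_eigen_block_r m n (M : 'M[A]_m) (N : 'M[A]_(n, m)) (P : 'M[A]_n) v f :
  right_eigen P v f -> right_eigen (block_mx M 0 N P) (col_mx 0 v) f.
Proof.
rewrite /right_eigen => Pv.
by rewrite mul_block_col mul_col_mx !mulmx0 !mul0mx !add0r Pv.
Qed.

End BlockEigenvectors.

(** * Lambda on the gradients of x_+, x_{3\0}, x_- in the spinor basis *)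

Section SpinorEigenvectors.
Variables (R : realType) (q : R) (q_gt0 : 0 < q) (q_neq1 : q != 1).
Variables (X : algType R[i]) (x : 'I_4 -> X).

Lemma right_eigen_mx2_l (a b d : X) :
  right_eigen (mx2 a b 0 d) (delta_mx (@lshift 1 1 0) 0) a.
Proof.
rewrite /mx2 delta_mx_ushift (raddf0 (@scalar_mx X 1)).
apply: (@right_eigen_block_l _ X 1 1).
by rewrite /right_eigen [delta_mx 0 0]mx11_scalar mxE !eqxx mulmx1 mul1mx.
Qed.

Lemma right_eigen_mx2_r (a c d : X) :
  right_eigen (mx2 a 0 c d) (delta_mx (@rshift 1 1 0) 0) d.
Proof.
rewrite /mx2 delta_mx_dshift (raddf0 (@scalar_mx X 1)).
apply: (@right_eigen_block_r _ X 1 1).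
by rewrite /right_eigen [delta_mx 0 0]mx11_scalar mxE !eqxx mulmx1 mul1mx.
Qed.

(** The indices are compared as natural numbers because they live in different ordinal types. *)
Lemma right_eigen_4l (M N P : 'M[X]_2) (i : 'I_2) (j : 'I_4) f :
  j = i :> nat -> right_eigen M (delta_mx i 0) f ->
  right_eigen (block_mx M N 0 P : 'M_4) (delta_mx j 0) f.
Proof.
move=> ji Mi; rewrite (_ : delta_mx j 0 = col_mx (delta_mx i 0) 0).
  by apply: (@right_eigen_block_l _ X 2 2).
by rewrite -delta_mx_ushift; congr delta_mx; apply: val_inj.
Qed.

Lemma right_eigen_4r (M N P : 'M[X]_2) (i : 'I_2) (j : 'I_4) f :
  j = (2 + i)%N :> nat -> right_eigen P (delta_mx i 0) f ->
  right_eigen (block_mx M 0 N P : 'M_4) (delta_mx j 0) f.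
Proof.
move=> ji Mi; rewrite (_ : delta_mx j 0 = @col_mx X 2 2 1 0 (delta_mx i 0)).
  by apply: (@right_eigen_block_r _ X 2 2).
by rewrite -delta_mx_dshift; congr delta_mx; apply: val_inj.
Qed.

Variables (L Lam : {rmorphism X -> 'M[X]_4}).
Hypotheses (HL : vector_action q x L) (HLam : scaled_action q x L Lam).

Lemma spinor_mx_delta j (r : R) (w : 'cV[R[i]]_4) :
  spinor_vector q j = r%:C *: w ->
  spinor_mx q X *m delta_mx j 0 = r%:C%:A *: map_mx (in_alg X) w.
Proof.
move=> jw; rewrite -colE; apply/matrixP => i k.
by rewrite scalemx_alg !mxE jw mxE scalerA (ord1 k).
Qed.

(** An eigenvector of M in spinor coordinates is transported to the standard basis; its
    normalisation r cancels, and degree one contributes the factor q. *)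
Lemma Lam_eigen f j (c r : R) (w : 'cV[R[i]]_4) M :
  homogeneous x 1 f -> r != 0 -> spinor_vector q j = r%:C *: w ->
  in_spinor_basis q (L f) M -> right_eigen M (delta_mx j 0) (c%:C *: f) ->
  Lam f *m map_mx (in_alg X) w
  = (q * c)%:C%:A *: (map_mx (in_alg X) w *m f%:M).
Proof.
move=> f1 r0 jw LM Mj.
have rC0 : r%:C != 0 :> R[i] by rewrite fmorph_eq0.
rewrite (scaled_homogeneous HLam f1) expr1 -scalemxAl rmorphM -scalemx_algA.
congr (_ *: _); apply: (scalemx_alg_inj rC0).
rewrite -mulmx_algr -(spinor_mx_delta jw) mulmxA LM -mulmxA Mj mulmxA.
by rewrite (spinor_mx_delta jw) -scalemxAl scalar_mx_alg mulmx_algr.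
Qed.

Lemma homogeneous_generator a : homogeneous x 1 (x a).
Proof.
exists [:: (1, [tuple a])].
by rewrite big_seq1 /= big_seq1 scale1r.
Qed.

Lemma homogeneous_x3m0 : homogeneous x 1 (x3m0 x).
Proof.
exists [:: (1, [tuple i3]); (-1, [tuple i0])].
by rewrite unlock /= !mulr1 addr0 scale1r scaleN1r.
Qed.

(** [2] simplifies to q + q^-1 > 0 because q - q^-1 is nonzero for positive q other than 1. *)
Lemma r2_neq0 : r2 q != 0.
Proof.
rewrite /r2 sqrtr_eq0 -ltNge /qint.
have q0 : q != 0 by rewrite gt_eqF.
have -> : (q ^+ 2 - q ^- 2) / (q - q^-1) = q + q^-1.
  rewrite -exprVn subr_sqr mulrAC divff ?mul1r //.
  rewrite subr_eq0; apply: contra q_neq1 => /eqP E.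
  have : q ^+ 2 == 1 by rewrite expr2 {2}E divff.
  rewrite sqrf_eq1 => /orP[//|/eqP qN].
  by have := q_gt0; rewrite qN ltrNr oppr0 ltr10.
by rewrite addr_gt0 ?invr_gt0.
Qed.

Lemma rq_neq0 : rq q != 0.
Proof. by rewrite sqrtr_eq0 -ltNge. Qed.

(** Gradients of x_-, x_+ and x_{3\0}: up to normalisation the spinor vectors e_--, e_++ and e_-+,
    at positions [i0], [i3] and [im] of the spinor basis. *)
Let wm : 'cV[R[i]]_4 := delta_mx im 0.
Let wp : 'cV[R[i]]_4 := delta_mx ip 0.
Let w3 : 'cV[R[i]]_4 := delta_mx i3 0 - delta_mx i0 0.

(** In this and the next four relations, the first factor q is the degree scaling; the second, q or
    q^-1, is read off the diagonal of the spinor matrix. *)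
Lemma Lam_xm_xm : Lam (x im) *m map_mx (in_alg X) wm
  = (q * q)%:C%:A *: (map_mx (in_alg X) wm *m (x im)%:M).
Proof.
apply: (@Lam_eigen _ i0 _ _ _ _ (homogeneous_generator _) r2_neq0
  erefl (action_xm HL)).
by apply: (@right_eigen_4l _ _ _ (@lshift 1 1 0)) => //;
  apply/right_eigenZ/right_eigen_mx2_l.
Qed.

Lemma Lam_x3m0_xm : Lam (x3m0 x) *m map_mx (in_alg X) wm
  = (q * q^-1)%:C%:A *: (map_mx (in_alg X) wm *m (x3m0 x)%:M).
Proof.
apply: (@Lam_eigen _ i0 _ _ _ _ homogeneous_x3m0 r2_neq0 erefl (action_x3m0 HL)).
by apply: (@right_eigen_4l _ _ _ (@lshift 1 1 0)) => //; apply: right_eigen_mx2_l.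
Qed.

Lemma Lam_x3m0_x3m0 : Lam (x3m0 x) *m map_mx (in_alg X) w3
  = (q * q)%:C%:A *: (map_mx (in_alg X) w3 *m (x3m0 x)%:M).
Proof.
apply: (@Lam_eigen _ im _ _ _ _ homogeneous_x3m0 rq_neq0 erefl (action_x3m0 HL)).
by apply: (@right_eigen_4l _ _ _ (@rshift 1 1 0)) => //; apply: right_eigen_mx2_r.
Qed.

Lemma Lam_xp_x3m0 : Lam (x ip) *m map_mx (in_alg X) w3
  = (q * q^-1)%:C%:A *: (map_mx (in_alg X) w3 *m (x ip)%:M).
Proof.
apply: (@Lam_eigen _ im _ _ _ _ (homogeneous_generator _) rq_neq0
  erefl (action_xp HL)).
by apply: (@right_eigen_4l _ _ _ (@rshift 1 1 0)) => //;
  apply/right_eigenZ/right_eigen_mx2_r.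
Qed.

Lemma Lam_xp_xp : Lam (x ip) *m map_mx (in_alg X) wp
  = (q * q)%:C%:A *: (map_mx (in_alg X) wp *m (x ip)%:M).
Proof.
apply: (@Lam_eigen _ i3 _ _ _ _ (homogeneous_generator _) r2_neq0
  erefl (action_xp HL)).
by apply: (@right_eigen_4r _ _ _ (@rshift 1 1 0)) => //;
  apply/right_eigenZ/right_eigen_mx2_r.
Qed.

End SpinorEigenvectors.

(** With a = 1/2 this gives Pi_+ + Pi_- = 1. *)
Lemma complementary_halves (F : comNzRingType) (A : algType F) n (a : F)
    (M : 'M[A]_n) :
  a + a = 1 -> a%:A *: (1%:M + M) + a%:A *: (1%:M - M) = 1%:M.
Proof.
move=> aa; rewrite -scalerDr addrACA subrr addr0 scalerDr -scalerDl -scalerDl aa.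
by rewrite !scale1r.
Qed.

(** * Complex linearity of the terms of the formula *)

Section LinearFormula.
Variables (R : realType) (Xh : algType (K R)).

(** Linearity is over the complex constants of K only, since the operators act on xi_+ and xi_-
    themselves. *)
Definition Clinear (D : Xh -> Xh) : Prop :=
  forall (c : R[i]) f g, D (cK c *: f + g) = cK c *: D f + D g.

Lemma Clinear0 D : Clinear D -> D 0 = 0.
Proof.
move=> DL; have := DL (-1) 0 0.
by rewrite rmorphN1 scaler0 add0r scaleN1r addNr.
Qed.

Lemma ClinearZ D c f : Clinear D -> D (cK c *: f) = cK c *: D f.
Proof. by move=> DL; rewrite -[cK c *: f]addr0 DL Clinear0 // addr0. Qed.

Lemma mulmx_Clinear n p (M : 'M[Xh]_(n, p)) (D : Xh -> Xh) c f g : Clinear D ->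
  M *m (D (cK c *: f + g))%:M
  = (cK c)%:A *: (M *m (D f)%:M) + M *m (D g)%:M.
Proof.
move=> DL; rewrite DL (raddfD (@scalar_mx Xh p)) /= mulmxDr.
by rewrite scalar_mx_alg mulmx_algr.
Qed.

Lemma difference_Clinear D S : Clinear D -> Clinear S ->
  Clinear (fun f => D (S f - f)).
Proof.
move=> DL SL c f g; rewrite SL opprD addrACA -scalerBr; exact: DL.
Qed.

(** Lets linearity of a long sum be proved one summand at a time. *)
Lemma affine_add n p (a : Xh) (U V u v u' v' : 'M[Xh]_(n, p)) :
  U = a *: u + v -> V = a *: u' + v' -> U + V = a *: (u + u') + (v + v').
Proof. by move=> -> ->; rewrite addrACA scalerDr. Qed.

Lemma mulmx_Clinear2 n p (P N : 'M[Xh]_n) (D D' : Xh -> Xh)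
    (w : 'M[Xh]_(n, p)) c f g :
  Clinear D -> Clinear D' ->
  (P *m (D (cK c *: f + g))%:M + N *m (D' (cK c *: f + g))%:M) *m w
  = (cK c)%:A *: ((P *m (D f)%:M + N *m (D' f)%:M) *m w)
    + (P *m (D g)%:M + N *m (D' g)%:M) *m w.
Proof.
move=> DL D'L; rewrite scalemxAl -[RHS]mulmxDl; congr (_ *m _).
by apply: affine_add; apply: mulmx_Clinear.
Qed.

End LinearFormula.

(** * The gradient formula on ordered monomials and their span *)

Section Gradient.
Variables (R : realType) (q : R) (q_gt0 : 0 < q) (q_neq1 : q != 1).
Variables (X : algType R[i]) (x : 'I_4 -> X).
Variables (L Lam : {rmorphism X -> 'M[X]_4}).
Hypotheses (HL : vector_action q x L) (HLam : scaled_action q x L Lam).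
Variables (nabla : X -> 'cV[X]_4) (Hnabla : gradient x Lam nabla).
Variables (Xh : algType (K R)) (iota : {rmorphism X -> Xh}).
Hypothesis Hover : over_center q x iota.
Variable Lamh : {rmorphism Xh -> 'M[Xh]_4}.
Hypothesis HLamh : extended_scaled_action q x iota L Lam Lamh.
Variable nablah : Xh -> 'cV[Xh]_4.
Hypothesis Hnablah : extended_gradient iota nabla Lamh nablah.

Let P := Pip q x iota L.
Let N := Pim q x iota L.
Let s : K R := rK (q ^+ 2).

Lemma Pip_Pim : P + N = 1%:M.
Proof.
apply: complementary_halves; rewrite -mulr2n -[LHS]mulr_natr mulVf //.
by rewrite -(rmorph_nat (@rK R)) fmorph_eq0 pnatr_eq0.
Qed.

Lemma Lamh_xi i j : Lamh (xip ^+ i * xin ^+ j)%:A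
  = (s ^+ i * (xip ^+ i * xin ^+ j))%:A *: P
    + (s ^+ j * (xip ^+ i * xin ^+ j))%:A *: N.
Proof.
(* A monomial in xi_+ and xi_- is a fraction with denominator 1. *)
have := ext_scaled_K HLamh ('X ^+ i * 'X%:P ^+ j) (oner_neq0 _).
rewrite !xi_eval_monomial !xi_eval1 tofrac1 !divr1 tofracM !tofracXn.
by rewrite !exprMn mulrA [xip ^+ i * _]mulrCA !mulmx_alg => ->; rewrite mulrA.
Qed.

Lemma s_neq1 : s != 1.
Proof.
rewrite -(rmorph1 (@rK R)) (inj_eq (fmorph_inj _)) sqrf_eq1 negb_or q_neq1 /=.
by apply: contraL q_gt0 => /eqP ->; rewrite ltrNr oppr0 ltr10.
Qed.

Lemma iota_columnE (w : 'cV[R[i]]_4) i j :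
  map_mx iota (map_mx (in_alg X) w) i j = (cK (w i j))%:A.
Proof. by rewrite !mxE; case: Hover => -> _ _; rewrite rmorph1. Qed.

Lemma central_iota_column (w : 'cV[R[i]]_4) :
  central_column (n := 3) (map_mx iota (map_mx (in_alg X) w)).
Proof.
move=> a; rewrite mul_scalar_mx; apply/matrixP => i j.
rewrite mxE iota_columnE mxE big_ord1 iota_columnE !mxE (ord1 j) eqxx.
by rewrite mulr_algr mulr_algl.
Qed.

Lemma eigencolumn_iota f (c : R) (k : K R) (w : 'cV[R[i]]_4) : rK c = k ->
  Lam f *m map_mx (in_alg X) w = c%:C%:A *: (map_mx (in_alg X) w *m f%:M) ->
  eigencolumn (n := 3) Lamh (iota f) k (map_mx iota (map_mx (in_alg X) w)).
Proof.
move=> <- fw; rewrite /eigencolumn (ext_scaled_X HLamh) -map_mxM fw map_mxZ.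
rewrite map_mxM map_scalar_mx; congr (_ *: _).
by case: Hover => -> _ _; rewrite rmorph1.
Qed.

Lemma nablah_generator a :
  nablah (iota (x a)) = map_mx iota (map_mx (in_alg X) (delta_mx a 0)).
Proof. by rewrite (ext_grad_X Hnablah) (grad_x Hnabla) !map_delta_mx. Qed.

Lemma nablah_x3m0 : nablah (iota (x3m0 x))
  = map_mx iota (map_mx (in_alg X) (delta_mx i3 0 - delta_mx i0 0)).
Proof.
rewrite (ext_grad_X Hnablah) /x3m0 addrC -scaleN1r (grad_linear Hnabla).
by rewrite !(grad_x Hnabla) map_mxB !map_delta_mx scaleN1r scaleN1r addrC.
Qed.

(** The geometric sum is the form produced by the product rule; the quotient form agrees with it
    because s differs from 1. *)
Lemma jintE m : rK (jint q m) = \sum_(i < m) s ^+ i.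
Proof.
have s1 : s - 1 != 0 by rewrite subr_eq0 s_neq1.
apply: (mulfI s1); rewrite -subrX1 /jint exprM -(rmorph1 (@rK R)) /s.
rewrite -(rmorphXn (@rK R)) -!(rmorphB (@rK R)) -(rmorphM (@rK R)) mulrC divfK //.
by rewrite -(fmorph_eq0 (@rK R)) rmorphB rmorph1.
Qed.

Variables (Dxip Dxin Dxp Dx3m0 Dxm Sxip Sxin : Xh -> Xh).
Hypotheses (HDxip : jackson_xip q x iota Dxip) (HDxin : jackson_xin q x iota Dxin).
Hypotheses (HDxp : jackson_xp q x iota Dxp) (HDx3m0 : jackson_x3m0 q x iota Dx3m0).
Hypothesis (HDxm : jackson_xm q x iota Dxm).
Hypotheses (HSxip : subst_xip q x iota Sxip) (HSxin : subst_xin q x iota Sxin).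

Definition jackson_gradient (f : Xh) : 'cV[Xh]_4 :=
  nablah xip%:A *m (Dxip f)%:M
  + nablah xin%:A *m (Dxin f)%:M
  + nablah (iota (x ip)) *m (Dxp f)%:M
  + nablah (iota (x3m0 x)) *m (Dx3m0 f)%:M
  + nablah (iota (x im)) *m (Dxm f)%:M
  + delta q x iota L Sxip Sxin Dxp f *m nablah (iota (x ip))
  + delta q x iota L Sxip Sxin Dx3m0 f *m nablah (iota (x3m0 x))
  + delta q x iota L Sxip Sxin Dxm f *m nablah (iota (x im)).

Lemma delta_Clinear D (w : 'cV[Xh]_4) c f g : Clinear D ->
  delta q x iota L Sxip Sxin D (cK c *: f + g) *m w
  = (cK c)%:A *: (delta q x iota L Sxip Sxin D f *m w)
    + delta q x iota L Sxip Sxin D g *m w.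
Proof.
move=> DL; apply: (@mulmx_Clinear2 _ _ _ _ P N (fun f => D (Sxip f - f))
  (fun f => D (Sxin f - f))).
  exact: difference_Clinear DL HSxip.1.
exact: difference_Clinear DL HSxin.1.
Qed.

Lemma jackson_gradient_linear c f g : jackson_gradient (cK c *: f + g)
  = (cK c)%:A *: jackson_gradient f + jackson_gradient g.
Proof.
apply: affine_add (delta_Clinear _ _ _ _ HDxm.1).
apply: affine_add (delta_Clinear _ _ _ _ HDx3m0.1).
apply: affine_add (delta_Clinear _ _ _ _ HDxp.1).
apply: affine_add (mulmx_Clinear _ _ _ _ HDxm.1).
apply: affine_add (mulmx_Clinear _ _ _ _ HDx3m0.1).
apply: affine_add (mulmx_Clinear _ _ _ _ HDxp.1).
apply: affine_add (mulmx_Clinear _ _ _ _ HDxin.1).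
exact: mulmx_Clinear HDxip.1.
Qed.

(** On a monomial the substitution is multiplication by a constant, which yields the factors s^i - 1
    of [gradient_mono]. *)
Lemma difference_eigen (D S : Xh -> Xh) (h : Xh) (c : R) :
  Clinear D -> S h = rK c *: h ->
  D (S h - h) = (rK c - 1) *: D h.
Proof.
move=> DL ->; rewrite -{2}[h]scale1r -scalerBl -(rmorph1 (@rK R)).
by rewrite -(rmorphB (@rK R)); exact: ClinearZ.
Qed.

Lemma nablah_monomial m n l k p : l = 0%N \/ p = 0%N ->
  nablah (monomial x iota m n l k p) = jackson_gradient (monomial x iota m n l k p).
Proof.
move=> lp.
have nM := ext_grad_mul Hnablah.
have qV : q * q^-1 = 1 by rewrite divff // gt_eqF.
have oneE : rK (q * q^-1) = 1 by rewrite qV rmorph1.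
have G := @gradient_mono _ _ 3 Lamh nablah nM P N xip xin s (xip_neq0 R)
  (xin_neq0 R) s_neq1 Pip_Pim Lamh_xi (iota (x ip)) (iota (x3m0 x)) (iota (x im)).
rewrite /jackson_gradient /delta.
rewrite !(difference_eigen HDxp.1 (HSxip.2 _ _ _ _ _ lp)).
rewrite !(difference_eigen HDxp.1 (HSxin.2 _ _ _ _ _ lp)).
rewrite !(difference_eigen HDx3m0.1 (HSxip.2 _ _ _ _ _ lp)).
rewrite !(difference_eigen HDx3m0.1 (HSxin.2 _ _ _ _ _ lp)).
rewrite !(difference_eigen HDxm.1 (HSxip.2 _ _ _ _ _ lp)).
rewrite !(difference_eigen HDxm.1 (HSxin.2 _ _ _ _ _ lp)).
rewrite (HDxip.2 _ _ _ _ _ lp) (HDxin.2 _ _ _ _ _ lp) (HDxp.2 _ _ _ _ _ lp).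
rewrite (HDx3m0.2 _ _ _ _ _ lp) (HDxm.2 _ _ _ _ _ lp) !jintE.
rewrite !(rmorphXn (@rK R) _ (q ^+ 2)) -/s -/P -/N.
(* What remains are the five eigenvector relations and the centrality of three constant columns;
   [erefl s] is accepted because [q ^+ 2] computes to [q * q]. *)
apply: G lp; rewrite ?nablah_x3m0 ?nablah_generator.
- exact: eigencolumn_iota (erefl s) (Lam_xp_xp q_gt0 q_neq1 HL HLam).
- exact: eigencolumn_iota (erefl s) (Lam_x3m0_x3m0 q_gt0 HL HLam).
- exact: eigencolumn_iota (erefl s) (Lam_xm_xm q_gt0 q_neq1 HL HLam).
- exact: eigencolumn_iota oneE (Lam_xp_x3m0 q_gt0 HL HLam).
- exact: eigencolumn_iota oneE (Lam_x3m0_xm q_gt0 q_neq1 HL HLam).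
- exact: central_iota_column.
- exact: central_iota_column.
- exact: central_iota_column.
Qed.

Lemma nablah_ordered_span f :
  ordered_span x iota f -> nablah f = jackson_gradient f.
Proof.
elim=> [m n l j p lp|c g h _ IHg _ IHh]; first exact: nablah_monomial.
by rewrite (ext_grad_linear Hnablah) IHg IHh jackson_gradient_linear.
Qed.

End Gradient.

(* X^4 is a right X-module, as in the product rule for the gradient: the
   product of the derivative of f by xi_+ (resp. xi_-) and the column
   nabla xi_+ (resp. nabla xi_-) multiplies the entries on the right. *)
Theorem mainTheorem4 (R : realType) (q : R) (q_gt0 : 0 < q) (q_neq1 : q != 1)
  (X : algType R[i]) (x : 'I_4 -> X) (HX : quantum_minkowski q x)
  (L Lam : {rmorphism X -> 'M[X]_4})
  (HL : vector_action q x L) (HLam : scaled_action q x L Lam)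
  (nabla : X -> 'cV[X]_4) (Hnabla : gradient x Lam nabla)
  (Xh : algType (K R)) (iota : {rmorphism X -> Xh})
  (HXh : separated_extension q x iota)
  (Lamh : {rmorphism Xh -> 'M[Xh]_4})
  (HLamh : extended_scaled_action q x iota L Lam Lamh)
  (nablah : Xh -> 'cV[Xh]_4)
  (Hnablah : extended_gradient iota nabla Lamh nablah)
  (Dxip Dxin Dxp Dx3m0 Dxm Sxip Sxin : Xh -> Xh)
  (HDxip : jackson_xip q x iota Dxip) (HDxin : jackson_xin q x iota Dxin)
  (HDxp : jackson_xp q x iota Dxp) (HDx3m0 : jackson_x3m0 q x iota Dx3m0)
  (HDxm : jackson_xm q x iota Dxm)
  (HSxip : subst_xip q x iota Sxip) (HSxin : subst_xin q x iota Sxin)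
  (f : X) :
  map_mx iota (nabla f) =
      nablah xip%:A *m (Dxip (iota f))%:M
    + nablah xin%:A *m (Dxin (iota f))%:M
    + nablah (iota (x ip)) *m (Dxp (iota f))%:M
    + nablah (iota (x3m0 x)) *m (Dx3m0 (iota f))%:M
    + nablah (iota (x im)) *m (Dxm (iota f))%:M
    + delta q x iota L Sxip Sxin Dxp (iota f) *m nablah (iota (x ip))
    + delta q x iota L Sxip Sxin Dx3m0 (iota f) *m nablah (iota (x3m0 x))
    + delta q x iota L Sxip Sxin Dxm (iota f) *m nablah (iota (x im)).
Proof.
have Hover := sep_over_center HXh.
(* The left side becomes [nablah (iota f)], and [iota f] lies in the ordered span. *)
rewrite -(ext_grad_X Hnablah).
apply: (nablah_ordered_span q_gt0 q_neq1 HL HLam Hnabla Hover HLamh Hnablah) => //.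
exact: (iota_span q_gt0 (mink_rel HX) Hover (mink_gen HX)).
Qed.
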